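(* Let $L=\mathbb{Q}(\sqrt{3})$ with ring of integers $O_L$, and let $$f_8(q):=\sum_{n=1}^{\infty}\frac{(q)_{2n-1}}{(q^{2n};q^2)_n}\,q^n.$$ Then $$q^{-1}f_8(q^3)=\sum_{\substack{\mathbf{a}\subset O_L\\ \mathcal{N}(\mathbf{a})\equiv 2\pmod 3}}(-1)^{\mathcal{N}(\mathbf{a})}q^{\mathcal{N}(\mathbf{a})},$$ where the sum runs over the nonzero ideals $\mathbf{a}$ of $O_L$ with $\mathcal{N}(\mathbf{a})\equiv 2\pmod 3$.
   Context: Identities are between formal power series in $q$ (equivalently, for $0<|q|<1$). Notation: $(a;q)_n:=\prod_{j=0}^{n-1}(1-aq^j)$ and $(a)_n:=(a;q)_n$; thus $(q)_n=\prod_{j=1}^n(1-q^j)$ and $(q^{2n};q^2)_n=\prod_{j=0}^{n-1}(1-q^{2n+2j})$. For an ideal $\mathbf{a}$ of $O_L$, $\mathcal{N}(\mathbf{a})=|O_L/\mathbf{a}|$ is its norm. *)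

(* Defs.v *)
From HB Require Import structures.
From mathcomp Require Import all_boot all_order all_algebra all_field finmap.
From mathcomp Require Import boolp classical_sets functions cardinality fsbigop.

Set Implicit Arguments.
Unset Strict Implicit.
Unset Printing Implicit Defensive.

Import Order.TTheory GRing.Theory Num.Theory.
Local Open Scope classical_set_scope.
Local Open Scope ring_scope.

(** A wrapper around [nat -> R], so that the product is the Cauchy product and
    not the pointwise product that functions carry in mathcomp-classical. *)

Record fps (R : Type) := Fps { fps_coef : nat -> R }.

Notation "F .[^ n ]" := (fps_coef F n)
  (at level 1, left associativity, format "F .[^ n ]") : ring_scope.

Lemma fpsP (R : Type) (F G : fps R) : (forall n, F.[^n] = G.[^n]) <-> F = G.
Proof.
by split=> [|-> //]; case: F G => [f] [g] /= fg; congr Fps; exact/funext.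
Qed.

HB.instance Definition _ (R : Type) := gen_eqMixin (fps R).
HB.instance Definition _ (R : Type) := gen_choiceMixin (fps R).

Section FpsRing.
Variable R : comNzRingType.
Implicit Types F G H : fps R.

Definition fps_zero : fps R := Fps (fun=> 0).
Definition fps_opp F : fps R := Fps (fun n => - F.[^n]).
Definition fps_add F G : fps R := Fps (fun n => F.[^n] + G.[^n]).
Definition fps_one : fps R := Fps (fun n => (n == 0)%:R).
Definition fps_mul F G : fps R :=
  Fps (fun n => \sum_(i < n.+1) F.[^i] * G.[^n - i]).

Fact fps_addA : associative fps_add.
Proof. by move=> F G H; apply/fpsP => n /=; rewrite addrA. Qed.
Fact fps_addC : commutative fps_add.
Proof. by move=> F G; apply/fpsP => n /=; rewrite addrC. Qed.
Fact fps_add0 : left_id fps_zero fps_add.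
Proof. by move=> F; apply/fpsP => n /=; rewrite add0r. Qed.
Fact fps_addN : left_inverse fps_zero fps_opp fps_add.
Proof. by move=> F; apply/fpsP => n /=; rewrite addNr. Qed.

HB.instance Definition _ :=
  GRing.isZmodule.Build (fps R) fps_addA fps_addC fps_add0 fps_addN.

Let trunc n F : {poly R} := \poly_(i < n.+1) F.[^i].

Let trunc_mul n F G k : (k <= n)%N ->
  (fps_mul F G).[^k] = (trunc n F * trunc n G)`_k.
Proof.
move=> kn; rewrite coefM; apply: eq_bigr => i _.
rewrite !coef_poly !ltnS (leq_trans (leq_subr _ _) kn).
by rewrite (leq_trans _ kn) // -ltnS.
Qed.

Fact fps_mulC : commutative fps_mul.
Proof.
by move=> F G; apply/fpsP => n; rewrite !(trunc_mul _ _ (leqnn n)) mulrC.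
Qed.

Fact fps_mulA : associative fps_mul.
Proof.
move=> F G H; apply/fpsP => n.
transitivity ((trunc n F * (trunc n G * trunc n H))`_n).
  rewrite coefM; apply: eq_bigr => i _.
  by rewrite -(trunc_mul _ _ (leq_subr _ _)) coef_poly ltn_ord.
rewrite mulrA coefM; apply: eq_bigr => i _.
have le_in : (i <= n)%N by rewrite -ltnS.
by rewrite -(trunc_mul _ _ le_in) coef_poly ltnS leq_subr.
Qed.

Fact fps_mul1 : left_id fps_one fps_mul.
Proof.
move=> F; apply/fpsP => n /=.
by rewrite big_ord_recl /= mul1r subn0 big1 ?addr0 // => i _; rewrite mul0r.
Qed.

Fact fps_mulDl : left_distributive fps_mul fps_add.
Proof.
move=> F G H; apply/fpsP => n /=; rewrite -big_split.
by apply: eq_bigr => i _ /=; rewrite mulrDl.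
Qed.

Fact fps_one_neq0 : fps_one != 0.
Proof.
by apply/eqP => /fpsP /(_ 0) /eqP; rewrite /= oner_eq0.
Qed.

HB.instance Definition _ := GRing.Zmodule_isComNzRing.Build (fps R)
  fps_mulA fps_mulC fps_mul1 fps_mulDl fps_one_neq0.

Definition fps_unit : {pred fps R} := fun F => `[< exists G, G * F = 1 >].
Definition fps_inv F : fps R :=
  if pselect (exists G, G * F = 1) is left FU then projT1 (cid FU) else F.

Fact fps_mulVr : {in fps_unit, left_inverse 1 fps_inv *%R}.
Proof.
move=> F /asboolP FU; rewrite /fps_inv; case: pselect => // FU'.
exact: (projT2 (cid FU')).
Qed.
Fact fps_unitPl F G : G * F = 1 -> fps_unit F.
Proof. by move=> GF; apply/asboolP; exists G. Qed.
Fact fps_inv_out : {in [predC fps_unit], fps_inv =1 id}.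
Proof.
by move=> F /asboolP FU; rewrite /fps_inv; case: pselect => // /FU.
Qed.

HB.instance Definition _ := GRing.ComNzRing_hasMulInverse.Build (fps R)
  fps_mulVr fps_unitPl fps_inv_out.

Lemma fps_coef0 n : (0 : fps R).[^n] = 0. Proof. by []. Qed.
Lemma fps_coef1 n : (1 : fps R).[^n] = (n == 0)%:R. Proof. by []. Qed.
Lemma fps_coefN F n : (- F).[^n] = - F.[^n]. Proof. by []. Qed.
Lemma fps_coefD F G n : (F + G).[^n] = F.[^n] + G.[^n]. Proof. by []. Qed.
Lemma fps_coefB F G n : (F - G).[^n] = F.[^n] - G.[^n]. Proof. by []. Qed.
Lemma fps_coefM F G n :
  (F * G).[^n] = \sum_(i < n.+1) F.[^i] * G.[^n - i].
Proof. by []. Qed.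
Lemma fps_coef_sum I (r : seq I) (P : pred I) (E : I -> fps R) n :
  (\sum_(i <- r | P i) E i).[^n] = \sum_(i <- r | P i) (E i).[^n].
Proof.
by elim/big_rec2: _ => // i x y _ <-; rewrite fps_coefD.
Qed.
Lemma fps_coef0M F G : (F * G).[^0] = F.[^0] * G.[^0].
Proof. by rewrite fps_coefM big_ord1. Qed.

Definition fpsX : fps R := Fps (fun n => (n == 1)%:R).

Lemma fps_coefXM F n : (fpsX * F).[^n] = if n is m.+1 then F.[^m] else 0.
Proof.
rewrite fps_coefM; case: n => [|n]; first by rewrite big_ord1 mul0r.
rewrite 2!big_ord_recl /= mul0r add0r mul1r subn1 big1 ?addr0 // => i _.
by rewrite mul0r.
Qed.

Lemma fps_coefXnM k F n :
  (fpsX ^+ k * F).[^n] = if (n < k)%N then 0 else F.[^n - k].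
Proof.
elim: k n => [|k IHk] n; first by rewrite expr0 mul1r subn0.
by rewrite exprS -mulrA fps_coefXM; case: n => // n; rewrite IHk ltnS subSS.
Qed.

Lemma fps_coef_expr_lt F k n : F.[^0] = 0 -> (n < k)%N -> (F ^+ k).[^n] = 0.
Proof.
move=> F0; elim: k n => // k IHk n nk; rewrite exprS fps_coefM big1 // => i _.
have [-> | i0] := eqVneq (i : nat) 0; first by rewrite F0 mul0r.
have le_in : (i <= n)%N by rewrite -ltnS.
rewrite IHk ?mulr0 //; case: n nk i le_in i0 => [|n] nk i le_in i0.
  by move: le_in; rewrite leqn0 (negbTE i0).
by rewrite (leq_trans _ (_ : n.+1 <= k)%N) // ltn_subrL lt0n i0.
Qed.

(** Division by [q]: the true quotient when the constant term vanishes, see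
    [fps_divXK]; otherwise the constant term is dropped. *)
Definition fps_divX F : fps R := Fps (fun n => F.[^n.+1]).

Lemma fps_divXK F : F.[^0] = 0 -> fpsX * fps_divX F = F.
Proof. by move=> F0; apply/fpsP => -[|n]; rewrite fps_coefXM. Qed.

(** The substitution [F(q) |-> F(q^k)], for [k > 0]. *)
Definition fps_dilate k F : fps R :=
  Fps (fun n => if (k %| n)%N then F.[^n %/ k] else 0).

(** Formal summation of a family: the coefficients of the sum are finite sums
    as soon as the family is summable (the junk value of [\sum_(i \in D)] on
    an infinite support is [0]). *)
Definition fps_summable (I : choiceType) (D : set I) (E : I -> fps R) :=
  forall n, finite_set [set i | D i /\ (E i).[^n] != 0].

Definition fps_sum (I : choiceType) (D : set I) (E : I -> fps R) : fps R :=
  Fps (fun n => \sum_(i \in D) (E i).[^n]).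

End FpsRing.

Arguments fpsX {R}.

Lemma fps_unit1B (R : comNzRingType) (D : fps R) :
  D.[^0] = 0 -> 1 - D \is a GRing.unit.
Proof.
move=> D0; pose geo n : fps R := \sum_(i < n) D ^+ i.
pose G : fps R := Fps (fun n => (geo n.+1).[^n]).
have geoE k n : (k < n)%N -> (geo n).[^k] = G.[^k].
  move=> kn; rewrite /G /= /geo !fps_coef_sum -(subnKC kn) big_split_ord /=.
  rewrite [X in _ + X]big1 ?addr0 // => i _.
  by rewrite fps_coef_expr_lt // ltn_addr.
suff GD : G * (1 - D) = 1 by apply/asboolP; exists G.
apply/fpsP => n; rewrite fps_coefM.
transitivity ((geo n.+1 * (1 - D)).[^n]).
  by rewrite fps_coefM; apply: eq_bigr => i _; rewrite geoE.
rewrite mulrC -opprB mulNr -subrX1 opprB fps_coefB.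
by rewrite fps_coef_expr_lt // subr0.
Qed.

Definition qpoch (R : comNzRingType) (a q : R) (n : nat) : R :=
  \prod_(j < n) (1 - a * q ^+ j).

Notation q := (@fpsX int).

Definition f8_term (n : nat) : fps int :=
  qpoch q q (2 * n - 1) / qpoch (q ^+ (2 * n)) (q ^+ 2) n * q ^+ n.

Definition f8 : fps int := fps_sum [set n : nat | (1 <= n)%N] f8_term.

Lemma f8_denom_unit n : (1 <= n)%N ->
  qpoch (q ^+ (2 * n)) (q ^+ 2) n \is a GRing.unit.
Proof.
move=> n0; rewrite /qpoch; apply: rpred_prod => j _; apply: fps_unit1B.
by rewrite -exprM -exprD -[_ ^+ _]mulr1 fps_coefXnM addn_gt0 muln_gt0 n0.
Qed.

Lemma f8_summable : fps_summable [set n : nat | (1 <= n)%N] f8_term.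
Proof.
move=> k; apply: (sub_finite_set _ (finite_II k.+1)) => n [_] nz.
rewrite /= ltnS leqNgt; apply: contra nz => kn.
by rewrite /f8_term mulrC fps_coefXnM kn.
Qed.

Lemma f8_coef0 : f8.[^0] = 0.
Proof.
by apply: fsbig1 => n n1; rewrite /f8_term mulrC fps_coefXnM n1.
Qed.

Definition L : set algC :=
  [set x | exists a b : rat, x = ratr a + ratr b * sqrtC 3].

Definition O_L : set algC := [set x | L x /\ x \in Aint].

Definition is_ideal (I : set algC) : Prop :=
  [/\ I `<=` O_L, I 0, forall x y, I x -> I y -> I (x + y)
    & forall a x, O_L a -> I x -> I (a * x)].

Definition cosets (I : set algC) : set (set algC) :=
  [set [set x + y | y in I] | x in O_L].

(** The cardinality of [O_L / I], with junk value [0] when the index is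
    infinite, which occurs only for the zero ideal. *)
Definition ideal_norm (I : set algC) : nat := #|` fset_set (cosets I)|.

(* Main.v *)
Require Import Defs.
From mathcomp Require Import all_boot all_order all_algebra all_field finmap.
From mathcomp Require Import boolp classical_sets functions cardinality fsbigop.
From mathcomp Require Import ring zify.

(** Both sides are evaluated as sums over two integer parameters k, l >= 0 and
    a bit e, and these sums agree term by term.

    On the analytic side, put Q = q^2 and let [(Q)_n] be (Q;Q)_n. The
    summand of index s + 1 of f8 is [(Q)_s q^(s+1) / (-q;q)_(2s+1)]
    ([f8_termE]). The reciprocal is expanded as an alternating series of
    Gaussian binomials in base Q ([qpochN_mul_recip_sum]). Collecting the
    terms gives
      [f8 = sum_n q^(n+1) (1 + q^(2n+2)) p_n(Q)],
    where [p_n] is a finite sum ([diag_sum]); in the language of Bailey pairs,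
    this is Bailey's lemma combined with the inversion formula. A certificate
    of creative telescoping yields a recurrence of order two for [p_n], whose
    solution is [p_n = (-1)^n Q^(n(n+1)/2) sum_(k <= n) Q^(k(n-k))]
    ([diag_sumE]). With n = k + l this becomes
      [f8 = sum_(k, l >= 0) (-1)^n (q^((n+1)^2 + 2kl) + q^((n+1)(n+3) + 2kl))]
    ([f8_coef]).

    On the arithmetic side, the ring of integers is Z[sqrt3] ([O_LP]), which is
    Euclidean, so every ideal is principal ([ideal_principal]); the ideal of
    [a + b sqrt3] has norm [|a^2 - 3b^2|] ([ideal_norm_principal]). If this
    number is 2 modulo 3, then [a^2 - 3b^2] is negative and 3 does not divide a
    ([nrm3_mod3]). The fundamental unit [2 + sqrt3] has norm 1, and
    [u > 0, y > 0, 2u < 3y] describes a fundamental domain for multiplication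
    by units on the elements [- u + y sqrt3] of negative norm with u prime to
    3: each ideal has exactly one such generator ([reduced_exists],
    [reduced_unique]). These pairs are u = 3k + 1 + e, y = 2k + l + 1 + e with
    e in {0, 1}, and [(3y^2 - u^2 + 1)/3] is the exponent of the theta series
    belonging to e, k and l ([reduced_nrm3]). The signs agree because this
    norm has the parity of k + l. *)

Set Implicit Arguments.
Unset Strict Implicit.
Unset Printing Implicit Defensive.

Import Order.TTheory GRing.Theory Num.Theory.
Local Open Scope ring_scope.

(** * The diagonal sums *)

Section QSeries.
Variables (R : comUnitRingType) (Q : R).
Hypothesis unitQ : forall k, 1 - Q ^+ k.+1 \is a GRing.unit.

Local Notation ph n := (qpoch Q Q n).

Lemma qpochS (a r : R) n : qpoch a r n.+1 = qpoch a r n * (1 - a * r ^+ n).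
Proof. by rewrite /qpoch big_ord_recr. Qed.

Lemma qpoch0 (a r : R) : qpoch a r 0 = 1.
Proof. by rewrite /qpoch big_ord0. Qed.

Lemma qpoch_selfS n : ph n.+1 = ph n * (1 - Q ^+ n.+1).
Proof. by rewrite qpochS -exprS. Qed.

Lemma qpoch_self_unit n : ph n \is a GRing.unit.
Proof.
by elim: n => [|n IH]; rewrite ?qpoch0 ?unitr1 // qpoch_selfS unitrM IH unitQ.
Qed.

Lemma qpoch_self_invS n : (ph n)^-1 = (1 - Q ^+ n.+1) * (ph n.+1)^-1.
Proof. by rewrite qpoch_selfS invrM ?qpoch_self_unit ?unitQ // mulVKr. Qed.

(** In the expansion of f8 (with Q the square of q), the part coming from the
    s-th summand of f8 and the d-th summand of its reciprocal factor; it is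
    [(-1)^d Q^(d(d-1)/2) (Q)_s] times the Gaussian binomial coefficient of
    d + 2s + 1 over d. *)
Definition diag_term d s : R :=
  (-1) ^+ d * Q ^+ 'C(d, 2) * (ph (d + 2 * s + 1) * ph s)
  / (ph (2 * s + 1) * ph d).

(** A certificate found by q-Zeilberger summation. Written with
    [(1 - Q^(e+s)) (1 + Q^s)] and [(Q)_(2s)] it has no pole at s = 0; the
    predecessor is harmless because only e + s > 0 occurs. *)
Definition diag_cert e s : R :=
  - (-1) ^+ e * Q ^+ 'C(e.+1, 2) * (1 - Q ^+ (e + s)) * (1 + Q ^+ s)
  * (ph (e + 2 * s).-1 * ph s) / (ph (2 * s) * ph e).

Lemma invr_qpoch2 m n : (ph m * ph n)^-1 = (ph m)^-1 * (ph n)^-1.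
Proof. by rewrite invrM ?qpoch_self_unit // mulrC. Qed.

(** Creative telescoping along a diagonal: the left-hand side, summed over
    constant e + s, is the recurrence operator applied to the diagonal sums,
    and the right-hand side collapses to a boundary term. *)
Lemma diag_cert_step2 e s :
  diag_term e.+2 s - Q ^+ (3 * (e + s) + 4) * diag_term e s
  = diag_cert e.+1 s.+1 - diag_cert e.+2 s.
Proof.
rewrite /diag_term /diag_cert !invr_qpoch2 !binS !bin0 !bin1.
have -> : (e.+2 + 2 * s + 1 = (e + 2 * s).+3)%N by lia.
have -> : (e + 2 * s + 1 = (e + 2 * s).+1)%N by lia.
have -> : ((e.+1 + 2 * s.+1).-1 = (e + 2 * s).+2)%N by lia.
have -> : ((e.+2 + 2 * s).-1 = (e + 2 * s).+1)%N by lia.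
have -> : (2 * s + 1 = (2 * s).+1)%N by lia.
have -> : (2 * s.+1 = (2 * s).+2)%N by lia.
(* Over the common factor C * D * A * B, both sides become polynomials. *)
rewrite (qpoch_self_invS (2 * s)) (qpoch_self_invS (2 * s).+1).
rewrite (qpoch_self_invS e) (qpoch_self_invS e.+1).
rewrite (qpoch_selfS (e + 2 * s).+2) (qpoch_selfS (e + 2 * s).+1).
rewrite (qpoch_selfS s).
move: (ph _)^-1 (ph _)^-1 (ph _) (ph _) => A B C D.
have -> : (3 * (e + s) + 4 = e * 3 + s * 3 + 4)%N by lia.
have E2 : (2 * s = s * 2)%N by lia.
rewrite E2 !(addSn, addnS) !exprS !exprD !exprM.
move: (Q ^+ e) (Q ^+ s) (Q ^+ 'C(e, 2)) ((-1) ^+ e) => x y z w.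
ring.
Qed.

(** The same telescoping at the end of the diagonal, where the shifted term
    with index d - 2 does not exist. *)
Lemma diag_cert_step1 s : diag_term 1 s = diag_cert 0 s.+1 - diag_cert 1 s.
Proof.
rewrite /diag_term /diag_cert !invr_qpoch2.
have -> : (1 + 2 * s + 1 = (2 * s).+2)%N by lia.
have -> : ((0 + 2 * s.+1).-1 = (2 * s).+1)%N by lia.
have -> : ((1 + 2 * s).-1 = (2 * s))%N by lia.
have -> : (2 * s + 1 = (2 * s).+1)%N by lia.
have -> : (2 * s.+1 = (2 * s).+2)%N by lia.
rewrite (qpoch_self_invS 0) (qpoch_self_invS (2 * s)).
rewrite (qpoch_self_invS (2 * s).+1).
move: (ph _)^-1 (ph _)^-1 => A B.
rewrite (qpoch_selfS (2 * s).+1) (qpoch_selfS (2 * s)) (qpoch_selfS s).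
rewrite binn bin_small //.
move: (ph _) (ph _) => C D.
have -> : (2 * s = s * 2)%N by lia.
rewrite add0n add1n !exprS !exprM; move: (Q ^+ s) => y.
ring.
Qed.

Lemma diag_cert_step0 s : diag_term 0 s.+1 = - diag_cert 0 s.+1.
Proof.
rewrite /diag_term /diag_cert !invr_qpoch2.
have -> : (0 + 2 * s.+1 + 1 = (2 * s).+3)%N by lia.
have -> : ((0 + 2 * s.+1).-1 = (2 * s).+1)%N by lia.
have -> : (2 * s.+1 = (2 * s).+2)%N by lia.
rewrite (qpoch_self_invS (2 * s).+2) bin_small // bin_small //.
move: (ph _)^-1 (ph _)^-1 => A B.
rewrite (qpoch_selfS (2 * s).+2) (qpoch_selfS (2 * s).+1).
move: (ph _) (ph _) => C D.
have -> : (2 * s = s * 2)%N by lia.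
rewrite add0n !exprS !exprM; move: (Q ^+ s) => y.
ring.
Qed.

Definition diag_sum n : R := \sum_(s < n.+1) diag_term (n - s) s.

Lemma diag_sum_rec n :
  diag_sum n.+2 =
  Q ^+ (3 * n + 4) * diag_sum n + 2 * (-1) ^+ n * Q ^+ 'C(n.+3, 2).
Proof.
rewrite /diag_sum 2!big_ord_recr /= subSnn subnn.
rewrite diag_cert_step1 diag_cert_step0.
pose u s := diag_cert (n.+2 - s) s.
have -> : \sum_(i < n.+1) diag_term (n.+2 - i) i =
    Q ^+ (3 * n + 4) * \sum_(s < n.+1) diag_term (n - s) s
    + \sum_(i < n.+1) (u i.+1 - u i).
  rewrite big_distrr -big_split /=; apply: eq_bigr => i _.
  have := diag_cert_step2 (n - i) i.
  have -> : (3 * (n - i + i) + 4 = 3 * n + 4)%N by have := ltn_ord i; lia.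
  have -> : ((n - i).+2 = n.+2 - i)%N by have := ltn_ord i; lia.
  have -> : ((n - i).+1 = n.+2 - i.+1)%N by have := ltn_ord i; lia.
  by rewrite -/(u i) -/(u i.+1) => <-; rewrite addrC subrK.
rewrite -(big_mkord xpredT (fun i => u i.+1 - u i)) telescope_sumr //.
have phV : ph n.+1 * ((1 - Q ^+ n.+2) * (ph n.+2)^-1) = 1.
  by rewrite -qpoch_self_invS divrr ?qpoch_self_unit.
have u0 : u 0%N = - (2 * (-1) ^+ n * Q ^+ 'C(n.+3, 2)).
  rewrite /u subn0 /diag_cert invr_qpoch2 !muln0 !addn0 !qpoch0 invr1 /=.
  transitivity (- (2 * (-1) ^+ n * Q ^+ 'C(n.+3, 2))
                * (ph n.+1 * ((1 - Q ^+ n.+2) * (ph n.+2)^-1))).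
    by rewrite 2!(exprS (-1)); ring.
  by rewrite phV mulr1.
have -> : diag_cert 1 n.+1 = u n.+1 by rewrite /u subSnn.
have -> : diag_cert 0 n.+2 = u n.+2 by rewrite /u subnn.
rewrite u0; ring.
Qed.

(** Both sides satisfy the recurrence of [diag_sum_rec]: on the right, the
    terms k = 0 and k = n + 2 give the inhomogeneous part, and shifting k by
    one turns the others into the sum for n, as
    (k + 1)(n + 1 - k) = k(n - k) + n + 1. *)
Lemma diag_sumE n :
  diag_sum n =
  (-1) ^+ n * Q ^+ 'C(n.+1, 2) * \sum_(k < n.+1) Q ^+ (k * (n - k)).
Proof.
elim/ltn_ind: n => -[|[|n]] IH.
- rewrite /diag_sum !big_ord1 /diag_term /= muln0 !expr0 !mul1r.
  by rewrite divrr ?unitrM ?qpoch_self_unit.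
- have b01 : diag_term 0 1 = 1 - Q.
    rewrite /diag_term bin_small // !expr0 !mul1r qpoch0 mulr1 add0n mulrAC.
    by rewrite divrr ?qpoch_self_unit // mul1r qpoch_selfS qpoch0 mul1r.
  have b10 : diag_term 1 0 = - (1 + Q).
    rewrite /diag_term bin_small // muln0 qpoch0 mulr1 expr1 expr0 mulr1.
    have -> : ph (1 + 0 + 1) = (1 + Q) * (ph (0 + 1) * ph 1).
      by rewrite !qpoch_selfS qpoch0; ring.
    by rewrite mulN1r mulNr mulrK ?unitrM ?qpoch_self_unit.
  rewrite /diag_sum 2!big_ord_recr big_ord0 /= b01 b10.
  rewrite 2!big_ord_recr big_ord0 /=; rewrite subnn muln0 mul0n.
  by ring.
rewrite diag_sum_rec IH // [in RHS]big_ord_recl [in RHS]big_ord_recr /=.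
rewrite subnn mul0n muln0 !expr0.
have -> : \sum_(i < n.+1) Q ^+ (bump 0 i * (n.+2 - bump 0 i)) =
          Q ^+ n.+1 * \sum_(k < n.+1) Q ^+ (k * (n - k)).
  rewrite big_distrr /=; apply: eq_bigr => i _; rewrite -exprD; congr (_ ^+ _).
  by have := ltn_ord i; rewrite /bump /=; nia.
have -> : Q ^+ 'C(n.+3, 2) = Q ^+ 'C(n.+1, 2) * Q ^+ (2 * n + 3).
  by rewrite -exprD !binS !bin1 !bin0; congr (_ ^+ _); lia.
have -> : Q ^+ (3 * n + 4) = Q ^+ (2 * n + 3) * Q ^+ n.+1.
  by rewrite -exprD; congr (_ ^+ _); lia.
rewrite 2!(exprS (-1)); ring.
Qed.
End QSeries.

(** * A series for the reciprocal of a q-Pochhammer symbol *)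

Section Recip.
Variables (R : comUnitRingType) (r : R).
Hypothesis unit_r2 : forall k, 1 - (r ^+ 2) ^+ k.+1 \is a GRing.unit.
Local Notation ph n := (qpoch (r ^+ 2) (r ^+ 2) n).

(** The fraction is the Gaussian binomial coefficient of m + d over d in
    base [r^2]. *)
Definition recip_term m d : R :=
  (-1) ^+ d * r ^+ (d ^ 2) * (ph (m + d) / (ph m * ph d))
  * (1 + r ^+ (m + 1 + 2 * d)).

Definition recip_rem m d : R :=
  if d is d'.+1 then
    (-1) ^+ d' * r ^+ (d ^ 2 + m.+1) * (ph (m.+1 + d') / (ph m.+1 * ph d'))
  else 0.

(** The Pascal rule and the absorption rule for Gaussian binomials: dividing
    by [1 + r^(m+1)] increases m up to a telescoping correction. *)
Lemma recip_term_rec m d :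
  recip_term m d =
  (1 + r ^+ m.+1) * (recip_term m.+1 d - (recip_rem m d.+1 - recip_rem m d)).
Proof.
rewrite /recip_term /recip_rem; case: d => [|d].
  rewrite !addn0 !qpoch0 !mulr1 !divrr ?(qpoch_self_unit unit_r2) // !addn1.
  by rewrite exp1n add1n !exprS !expr0; ring.
rewrite !(invr_qpoch2 unit_r2).
rewrite (qpoch_self_invS unit_r2 m) (qpoch_self_invS unit_r2 d).
move: (ph _)^-1 (ph _)^-1 => A B.
have -> : (m + d.+1 = m.+1 + d)%N by lia.
rewrite (addnS m.+1 d) (qpoch_selfS _ (m.+1 + d)); move: (ph _) => C.
have -> : (d.+2 ^ 2 = d ^ 2 + d * 4 + 4)%N by lia.
have -> : (d.+1 ^ 2 = d ^ 2 + d * 2 + 1)%N by lia.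
move: (d ^ 2)%N => D; rewrite -!exprM.
have -> : (2 * d.+1 = d * 2 + 2)%N by lia.
have -> : (2 * m.+1 = m * 2 + 2)%N by lia.
have -> : (2 * (m.+1 + d).+1 = m * 2 + d * 2 + 4)%N by lia.
rewrite !addn1 !(addSn, addnS) !exprS !addn0 !exprD !exprM.
ring.
Qed.

(** Truncated form of
    [1/(-r;r)_m = sum_d (-1)^d r^(d^2) [m+d, d] (1 + r^(m+1+2d))], with
    [[m+d, d]] the Gaussian binomial in base [r^2]. The error after K terms is
    a multiple of [r^(K^2)], so no infinite sum is needed to read off
    coefficients of power series. The induction on m starts from a telescoping
    sum. *)
Lemma qpochN_mul_recip_sum m K : exists H,
  qpoch (- r) r m * \sum_(d < K) recip_term m d = 1 + r ^+ (K ^ 2) * H.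
Proof.
elim: m => [|m [H IH]].
  exists (- (-1) ^+ K); rewrite qpoch0 mul1r.
  pose v d : R := (-1) ^+ d * r ^+ (d ^ 2).
  rewrite (eq_bigr (fun d : 'I_K => - (v d.+1 - v d))).
    rewrite sumrN -(big_mkord xpredT (fun i => v i.+1 - v i)) telescope_sumr //.
    rewrite /v exp0n // !expr0; ring.
  move=> d _; rewrite /recip_term /v !add0n qpoch0 mul1r.
  rewrite divrr ?qpoch_self_unit //.
  have -> : (d.+1 ^ 2 = d ^ 2 + (1 + 2 * d))%N by lia.
  by rewrite !exprD (exprS (-1)); ring.
have E : \sum_(d < K) recip_term m d =
    (1 + r ^+ m.+1) * (\sum_(d < K) recip_term m.+1 d - recip_rem m K).
  under eq_bigr => d _ do rewrite (recip_term_rec m).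
  rewrite -big_distrr /=; congr (_ * _).
  rewrite big_split /= sumrN.
  rewrite -(big_mkord xpredT (fun i => recip_rem m i.+1 - recip_rem m i)).
  by rewrite telescope_sumr // subr0.
have [G GE] : exists G, recip_rem m K = r ^+ (K ^ 2) * G.
  case: (K) => [|d]; first by exists 0; rewrite mulr0.
  by eexists; rewrite /= exprD -!mulrA mulrCA.
exists (H + qpoch (- r) r m.+1 * G).
have -> : qpoch (- r) r m.+1 = qpoch (- r) r m * (1 + r ^+ m.+1).
  by rewrite qpochS exprS mulNr opprK.
have -> : \sum_(d < K) recip_term m.+1 d =
    (\sum_(d < K) recip_term m.+1 d - recip_rem m K) + recip_rem m K.
  by rewrite subrK.
by rewrite mulrDr -!mulrA -E IH GE; ring.
Qed.

Lemma qpoch_sqr m : qpoch r r m * qpoch (- r) r m = ph m.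
Proof.
elim: m => [|m IH]; rewrite ?qpoch0 ?mulr1 // !qpochS -IH -!exprS -exprM.
by rewrite mulNr -exprS mulnC exprM; ring.
Qed.
End Recip.

Lemma qpoch_shift (R : comUnitRingType) (Q : R) s k :
  qpoch Q Q s * qpoch (Q ^+ s.+1) Q k = qpoch Q Q (s + k).
Proof.
elim: k => [|k IH]; first by rewrite qpoch0 mulr1 addn0.
by rewrite addnS !qpochS mulrA IH -exprD -exprS.
Qed.

(** * The series f8 as an indefinite theta series *)

Lemma sum_triangle (V : nmodType) (E : nat -> nat -> V) M :
  \sum_(k < M) \sum_(l < M - k) E k l =
  \sum_(n < M) \sum_(k < n.+1) E k (n - k)%N.
Proof.
elim: M => [|M IH]; first by rewrite !big_ord0.
rewrite [RHS]big_ord_recr -IH /= [LHS]big_ord_recr /= subSnn big_ord1.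
rewrite [X in _ = _ + X]big_ord_recr /= subnn addrA; congr (_ + _).
rewrite -big_split; apply: eq_bigr => k _ /=.
by rewrite subSn ?(ltnW (ltn_ord k)) // big_ord_recr.
Qed.

Lemma sum_square_diag (V : nmodType) (E : nat -> nat -> V) M :
  (forall k l, (M <= k + l)%N -> E k l = 0) ->
  \sum_(k < M) \sum_(l < M) E k l =
  \sum_(n < M) \sum_(k < n.+1) E k (n - k)%N.
Proof.
move=> E0; rewrite -sum_triangle; apply: eq_bigr => k _.
rewrite -!(big_mkord xpredT (E k)).
rewrite (big_cat_nat (leq0n (M - k)) (leq_subr _ _)) /=.
rewrite [X in _ + X]big_nat_cond [X in _ + X]big1 ?addr0 // => l.
by case/andP=> /andP[Hl _] _; apply: E0; rewrite -leq_subLR.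
Qed.

Lemma unit_1B_fpsX2 k : 1 - (q ^+ 2) ^+ k.+1 \is a GRing.unit.
Proof.
by apply: fps_unit1B; rewrite -exprM -[_ ^+ _]mulr1 fps_coefXnM.
Qed.

Lemma bin2_sqr d : ('C(d, 2) * 2 + d = d ^ 2)%N.
Proof. by elim: d => // d IH; rewrite binS bin1; nia. Qed.

(** Since [(q;q)_m (-q;q)_m = (q^2;q^2)_m], the quotient defining the term is
    [(q^2;q^2)_s / (-q;q)_(2s+1)]. *)
Lemma f8_termE s : f8_term s.+1 * qpoch (- q) q (2 * s + 1) =
  qpoch (q ^+ 2) (q ^+ 2) s * q ^+ s.+1.
Proof.
have U := f8_denom_unit (ltn0Sn s).
rewrite /f8_term.
have -> : (2 * s.+1 - 1 = 2 * s + 1)%N by lia.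
have E : qpoch q q (2 * s + 1) * qpoch (- q) q (2 * s + 1) =
    qpoch (q ^+ 2) (q ^+ 2) s * qpoch (q ^+ (2 * s.+1)) (q ^+ 2) s.+1.
  by rewrite qpoch_sqr exprM qpoch_shift; congr (qpoch _ _ _); lia.
rewrite [LHS]mulrAC [X in X * _]mulrAC E.
by rewrite mulrK.
Qed.

Lemma f8_term_expand s K : exists H,
  f8_term s.+1 =
  \sum_(d < K) diag_term (q ^+ 2) d s
                * (q ^+ (d + s).+1 * (1 + q ^+ (2 * (d + s).+1)))
  + q ^+ (K ^ 2) * H.
Proof.
have [H HE] := qpochN_mul_recip_sum unit_1B_fpsX2 (2 * s + 1) K.
exists (- f8_term s.+1 * H).
have E : f8_term s.+1 = f8_term s.+1 *
    (qpoch (- q) q (2 * s + 1) * \sum_(d < K) recip_term q (2 * s + 1) d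
     - q ^+ (K ^ 2) * H).
  by rewrite HE addrK mulr1.
rewrite {1}E mulrBr mulrA f8_termE; congr (_ + _); last by ring.
rewrite big_distrr; apply: eq_bigr => d _ /=.
rewrite /recip_term /diag_term -(bin2_sqr d).
have -> : (2 * s + 1 + 1 + 2 * d = 2 * (d + s).+1)%N by lia.
have -> : (2 * s + 1 + d = d + 2 * s + 1)%N by lia.
rewrite mulnC exprD exprM -addnS (exprD _ d s.+1).
by move: (_ * _)^-1 => V; ring.
Qed.

Lemma f8_coef_term m M : (m < M)%N ->
  f8.[^m] = \sum_(s < M) (f8_term s.+1).[^m].
Proof.
move=> mM.
rewrite /f8 /fps_sum /=.
rewrite (@reindex_fsbig _ _ _ _ _ succn setT); last first.
  split => //=.
    by move=> x y _ _ [].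
  by move=> [|n] //= _; exists n.
rewrite (fsbig_ord +%R M (fun s => (f8_term s.+1).[^m])).
symmetry; apply: fsbig_widen => //.
move=> i [_ /= /negP]; rewrite -leqNgt => Mi.
change ((f8_term i.+1).[^m] = 0).
by rewrite /f8_term mulrC fps_coefXnM (leq_trans mM) // ltnW // ltnS.
Qed.

Lemma fps_coefXn k n : (q ^+ k).[^n] = (n == k)%:R.
Proof.
rewrite -[_ ^+ _]mulr1 fps_coefXnM fps_coef1.
by case: ltngtP => [||->]; rewrite ?subnn // -subn_gt0; case: (_ - _)%N.
Qed.

(** With n = k + l, the exponents [(n+1)^2 + 2kl] for e = 0 and
    [(n+1)(n+3) + 2kl] for e = 1. *)
Definition theta_exp (e k l : nat) : nat :=
  ((k + l + 1) * (k + l + 1 + 2 * e) + 2 * k * l)%N.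

(** Expand every term of f8, collect the terms with d + s = n, which add up to
    [diag_sum (q^2) n] times [q^(n+1) (1 + q^(2n+2))], and insert the closed
    form of the diagonal sums. Terms of index at least M have order larger
    than m, which makes all the sums finite. *)
Lemma f8_coef m M : (m < M)%N ->
  f8.[^m] = \sum_(e < 2) \sum_(k < M) \sum_(l < M)
    (-1) ^+ (k + l) * (m == theta_exp e k l)%:R.
Proof.
move=> mM.
transitivity (\sum_(k < M) \sum_(l < M) (-1) ^+ (k + l) *
    ((m == (k + l + 1) ^ 2 + 2 * k * l)%N%:R
     + (m == (k + l + 1) * (k + l + 3) + 2 * k * l)%N%:R) : int); last first.
  rewrite big_ord_recr big_ord1 /= -big_split.
  apply: eq_bigr => k _; rewrite -big_split; apply: eq_bigr => l _ /=.
  rewrite mulrDr /theta_exp muln0 addn0 -mulnn.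
  by have -> : (k + l + 1 + 2 * 1 = k + l + 3)%N by lia.
rewrite (f8_coef_term mM).
pose G n : fps int := q ^+ n.+1 * (1 + q ^+ (2 * n.+1)).
have GE (F : fps int) n : (M <= n)%N -> (F * G n).[^m] = 0.
  move=> Mn; rewrite /G mulrCA fps_coefXnM.
  by rewrite (leq_trans mM) // (leq_trans Mn).
pose E s d := (diag_term (q ^+ 2) d s * G (s + d)%N).[^m].
transitivity (\sum_(s < M) \sum_(d < M) E s d).
  apply: eq_bigr => s _; have [H ->] := f8_term_expand s M.
  rewrite fps_coefD fps_coef_sum fps_coefXnM (leq_trans mM) ?addr0; last by nia.
  by apply: eq_bigr => d _; rewrite /E addnC.
rewrite sum_square_diag; last by move=> k l Hkl; apply: GE.
pose E' k l : int := (-1) ^+ (k + l) *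
    ((m == (k + l + 1) ^ 2 + 2 * k * l)%N%:R
     + (m == (k + l + 1) * (k + l + 3) + 2 * k * l)%N%:R).
rewrite [RHS](@sum_square_diag _ E'); last first.
  move=> k l Hkl; rewrite /E'.
  have /negPf -> : (m != (k + l + 1) ^ 2 + 2 * k * l)%N by nia.
  have /negPf -> : (m != (k + l + 1) * (k + l + 3) + 2 * k * l)%N by nia.
  by rewrite addr0 mulr0.
apply: eq_bigr => n _; rewrite /E.
rewrite (eq_bigr (fun s : 'I_n.+1 =>
    (diag_term (q ^+ 2) (n - s) s * G n).[^m])); last first.
  by move=> s _; rewrite subnKC // -ltnS.
rewrite -fps_coef_sum -mulr_suml -/(diag_sum (q ^+ 2) n).
rewrite (diag_sumE unit_1B_fpsX2).
rewrite mulr_sumr mulr_suml fps_coef_sum; apply: eq_bigr => k _.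
have kn : (k <= n)%N by rewrite -ltnS.
rewrite /E' (subnKC kn).
pose c := (2 * k * (n - k))%N.
have -> : (-1) ^+ n * q ^+ 2 ^+ 'C(n.+1, 2) * q ^+ 2 ^+ (k * (n - k)) * G n =
   (-1) ^+ n * (q ^+ ((n + 1) ^ 2 + c) + q ^+ ((n + 1) * (n + 3) + c)).
  have -> : ((n + 1) * (n + 3) + c = (n + 1) ^ 2 + c + 2 * n.+1)%N by lia.
  have -> : ((n + 1) ^ 2 + c = 'C(n.+1, 2) * 2 + n.+1 + k * (n - k) * 2)%N.
    by rewrite bin2_sqr /c addn1; lia.
  rewrite /G -!exprM [(2 * 'C(_, _))%N]mulnC [(2 * (k * _))%N]mulnC.
  by rewrite !exprD; ring.
rewrite -signr_odd -[in RHS]signr_odd.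
by case: odd; rewrite ?mulN1r ?mul1r ?fps_coefN fps_coefD !fps_coefXn.
Qed.

(** * The norm form and the ring of integers *)

Definition nrm3 (a b : int) : int := a ^+ 2 - 3 * b ^+ 2.

(** The exponent of 3 is even in [a^2] and odd in [3 b^2]. *)
Lemma nrm3_eq0 a b : nrm3 a b = 0 -> a = 0 /\ b = 0.
Proof.
move=> /eqP; rewrite /nrm3 subr_eq0 => /eqP E.
have E' : (`|a| ^ 2 = 3 * `|b| ^ 2)%N.
  by move/(congr1 absz): E; rewrite abszM !abszX.
suff b0 : b = 0 by split=> //; move: E; rewrite b0; nia.
have [/eqP|b0] := posnP `|b|%N; first by rewrite absz_eq0 => /eqP.
have := congr1 (fun n => odd (logn 3 n)) E'.
by rewrite lognM ?expn_gt0 ?b0 // !lognX /= !oddM.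
Qed.

Lemma nrm3M a b c d :
  nrm3 (a * c + 3 * (b * d)) (a * d + b * c) = nrm3 a b * nrm3 c d.
Proof. by rewrite /nrm3; ring. Qed.

Lemma round_div (p n : int) : n != 0 -> exists u, 2 * `|p - u * n| <= `|n|.
Proof.
move=> n0; have := divz_eq p n; have := modz_ge0 p n0; have := ltz_mod p n0.
move: (p %/ n)%Z (p %% n)%Z => u r r1 r2 ->.
have [r3|r3] := lerP (2 * r) `|n|.
  by exists u; rewrite addrAC subrr add0r ger0_norm.
exists (u + sgz n).
have -> : u * n + r - (u + sgz n) * n = r - sgz n * n by ring.
have -> : sgz n * n = `|n| by rewrite [RHS]normrEsg sgrEz intz.
by rewrite ler0_norm; lia.
Qed.

(** Euclidean division: rounding both coordinates of a quotient leaves an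
    error [p + r sqrt3] with p and r at most 1/2 in absolute value, and then
    [|p^2 - 3 r^2| <= 3/4]. *)
Lemma nrm3_euclid x y a b : (a, b) != (0, 0) ->
  exists u v, `|nrm3 (x - (a * u + 3 * (b * v))) (y - (a * v + b * u))|
              < `|nrm3 a b|.
Proof.
move=> ab0; have n0 : nrm3 a b != 0.
  by apply: contra ab0 => /eqP/nrm3_eq0 [-> ->].
have [u Hu] := round_div (x * a - 3 * (y * b)) n0.
have [v Hv] := round_div (y * a - x * b) n0.
exists u, v; rewrite -(ltr_pM2r (_ : 0 < `|nrm3 a b|)) ?normr_gt0 //.
rewrite -[X in X < _]normrM.
have -> : nrm3 (x - (a * u + 3 * (b * v))) (y - (a * v + b * u)) * nrm3 a b =
  (x * a - 3 * (y * b) - u * nrm3 a b) ^+ 2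
  - 3 * (y * a - x * b - v * nrm3 a b) ^+ 2 by rewrite /nrm3; ring.
move: Hu Hv n0.
move: (x * a - 3 * (y * b) - u * nrm3 a b) => p.
move: (y * a - x * b - v * nrm3 a b) => r; move: (nrm3 a b) => n Hp Hr n0.
have Hp2 : 4 * p ^+ 2 <= n ^+ 2 by nia.
have Hr2 : 4 * r ^+ 2 <= n ^+ 2 by nia.
have n2 : 0 < n ^+ 2 by nia.
rewrite -normrM -expr2 (ger0_norm (ltW n2)) ltr_norml; apply/andP; split; nia.

Qed.

(** Multiplying [- u + y sqrt3] by a unit [c + d sqrt3] with d > 0 leaves the
    reduced region: if c <= 0 then the new y is negative, and otherwise
    c <= 2d together with 2u < 3y makes the new u negative. *)
Lemma reduced_no_pos_unit (u y c d : int) : 0 < u -> 0 < y -> 2 * u < 3 * y ->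
  0 < d -> c ^+ 2 = 1 + 3 * d ^+ 2 -> 0 < c * u - 3 * (d * y) ->
  0 < c * y - d * u -> False.
Proof.
move=> u0 y0 uy d0 cd H1 H2.
have [c0|c0] := lerP c 0; first by nia.
have : c <= 2 * d by nia.
by nia.
Qed.

Definition zsqrt3 (a b : int) : algC := a%:~R + b%:~R * sqrtC 3.

Lemma sqrt3_sqr : sqrtC 3 * sqrtC 3 = 3 :> algC.
Proof. by rewrite -expr2 sqrtCK. Qed.

Lemma zsqrt3D a b c d : zsqrt3 a b + zsqrt3 c d = zsqrt3 (a + c) (b + d).
Proof. by rewrite /zsqrt3 !rmorphD /=; ring. Qed.

Lemma zsqrt3B a b c d : zsqrt3 a b - zsqrt3 c d = zsqrt3 (a - c) (b - d).
Proof. by rewrite /zsqrt3 !rmorphB /=; ring. Qed.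

Lemma zsqrt3M a b c d :
  zsqrt3 a b * zsqrt3 c d = zsqrt3 (a * c + 3 * (b * d)) (a * d + b * c).
Proof.
rewrite /zsqrt3 !rmorphD !rmorphM /=.
rewrite mulrDl !mulrDr.
have -> : b%:~R * sqrtC 3 * (d%:~R * sqrtC 3) = b%:~R * d%:~R * 3 :> algC.
  by rewrite mulrACA sqrt3_sqr.
by ring.
Qed.

Lemma rat_sqr3 (r : rat) : r ^+ 2 != 3.
Proof.
apply/eqP => E.
have : nrm3 (numq r) (denq r) = 0.
  apply/eqP; rewrite -(@eqr_int rat) /nrm3 rmorphB rmorphXn rmorphM rmorphXn /=.
  have d0 : (denq r)%:~R != 0 :> rat by rewrite intr_eq0 denq_eq0.
  rewrite subr_eq0; apply/eqP; move: E.
  rewrite -[in X in X -> _](divq_num_den r).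
  by rewrite expr_div_n => /(canRL (divfK _)) ->; rewrite // expf_neq0.
by case/nrm3_eq0 => _ /eqP; rewrite denq_eq0.
Qed.

Lemma sqrt3_indep (a b : rat) : ratr a + ratr b * sqrtC 3 = 0 :> algC ->
  a = 0 /\ b = 0.
Proof.
move=> E; have [b0|b0] := eqVneq b 0.
  move: E; rewrite b0 rmorph0 mul0r addr0 => /eqP.
  by rewrite fmorph_eq0 => /eqP ->.
have : sqrtC 3 = ratr (- a / b) :> algC.
  rewrite rmorphM rmorphN fmorphV /=; apply: (canRL (mulfK _)).
    by rewrite fmorph_eq0.
  by rewrite mulrC; apply/eqP; rewrite -addr_eq0 addrC E.
move/(congr1 (fun x => x ^+ 2)); rewrite sqrtCK -rmorphXn /= => /eqP.
rewrite -[3](ratr_nat _ 3) (inj_eq (fmorph_inj _)) eq_sym.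
by rewrite (negPf (rat_sqr3 _)).
Qed.

Lemma zsqrt3_eq0 a b : zsqrt3 a b = 0 -> a = 0 /\ b = 0.
Proof.
rewrite /zsqrt3 -!(ratr_int algC) => /sqrt3_indep [/eqP A /eqP B].
by move: A B; rewrite !intr_eq0 => /eqP -> /eqP ->.
Qed.

Lemma zsqrt3_inj a b c d : zsqrt3 a b = zsqrt3 c d -> a = c /\ b = d.
Proof.
move/eqP; rewrite -subr_eq0 zsqrt3B => /eqP/zsqrt3_eq0 [A B].
by split; apply/eqP; rewrite -subr_eq0 ?A ?B.
Qed.

Lemma Aint_sqrt3 : sqrtC 3 \in Aint.
Proof.
apply: (@root_monic_Aint ('X^2 - 3%:P)).
- by rewrite /root !hornerE sqrtCK subrr.
- by rewrite monicXnsubC.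
- apply/polyOverP => i; rewrite coefB coefXn coefC rpredB ?rpred_nat //.
  by case: (i == 0)%N; rewrite ?rpred0 ?rpred_nat.
Qed.

(** Conjugation without Galois theory: a rational polynomial takes values with
    the same rational coordinates at both square roots of 3. *)
Lemma horner_conj3 (p : {poly rat}) (a b : rat) : exists A B : rat,
  forall s : algC, s * s = 3 ->
  (map_poly ratr p).[ratr a + ratr b * s] = ratr A + ratr B * s.
Proof.
elim/poly_ind: p => [|p c [A [B IH]]].
  by exists 0, 0 => s _; rewrite rmorph0 horner0 rmorph0 mul0r addr0.
exists (A * a + 3 * (B * b) + c), (A * b + B * a) => s s3.
rewrite rmorphD rmorphM /= map_polyX map_polyC /= hornerMXaddC IH //.
rewrite !rmorphD !rmorphM /= ratr_nat -s3; ring.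
Qed.

Lemma Aint_conj3 (a b : rat) : ratr a + ratr b * sqrtC 3 \in Aint ->
  ratr a + ratr b * - sqrtC 3 \in Aint.
Proof.
set x := (X in X \in Aint -> _) => xA.
have [p [pE _] _] := minCpolyP x.
apply: (root_monic_Aint _ (minCpoly_monic x) xA).
have [A [B E]] := horner_conj3 p a b.
have := root_minCpoly x; rewrite /root pE !E ?mulrNN ?sqrt3_sqr // => /eqP.
by case/sqrt3_indep => -> ->; rewrite rmorph0 mul0r addr0.
Qed.

(** For an integral [x = a + b sqrt3] with conjugate y, the numbers
    x + y = 2a, xy and [(x - y) sqrt3 = 6b] are rational integers. Hence 2a and
    2b are integers m and c with [m^2 - 3c^2] divisible by 4, so both are
    even. *)
Lemma O_LP x : O_L x <-> exists a b, x = zsqrt3 a b.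
Proof.
split; last first.
  case=> a [b ->]; split; last by rewrite rpredD ?rpredM ?Aint_int ?Aint_sqrt3.
  by exists a%:~R, b%:~R; rewrite !ratr_int.
case=> -[a [b xE]] xA; have := xA; rewrite {1}xE => /Aint_conj3 yA.
pose y : algC := ratr a + ratr b * - sqrtC 3.
have ratA r (z : algC) : z = ratr r -> z \in Aint -> exists m : int, r = m%:~R.
  move=> zE zA; have /intrP [m mE] : z \is a Num.int.
    by apply: Cint_rat_Aint zA; rewrite zE; apply: Crat_rat.
  have : ratr r = ratr m%:~R :> algC by rewrite -zE mE ratr_int.
  by move/fmorph_inj; exists m.
have [m mE] : exists m : int, 2 * a = m%:~R.
  apply: (ratA _ (x + y)); last by rewrite rpredD.
  by rewrite xE /y rmorphM /= ratr_nat; ring.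
have [n nE] : exists n : int, a ^+ 2 - 3 * b ^+ 2 = n%:~R.
  apply: (ratA _ (x * y)); last by rewrite rpredM.
  rewrite xE /y rmorphB rmorphXn rmorphM rmorphXn /= ratr_nat.
  transitivity (ratr a ^+ 2 - (sqrtC 3 * sqrtC 3) * ratr b ^+ 2 : algC).
    by ring.
  by rewrite sqrt3_sqr.
have [t tE] : exists t : int, 6 * b = t%:~R.
  apply: (ratA _ ((x - y) * sqrtC 3)); last first.
    by rewrite rpredM ?rpredB ?Aint_sqrt3.
  rewrite xE /y rmorphM /= ratr_nat.
  transitivity (2 * ratr b * (sqrtC 3 * sqrtC 3) : algC); first by ring.
  by rewrite sqrt3_sqr; ring.
have tn : t ^+ 2 = 3 * (m ^+ 2 - 4 * n).
  apply/eqP; rewrite -(@eqr_int rat).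
  rewrite rmorphXn rmorphM rmorphB rmorphXn rmorphM /=.
  by rewrite -tE -mE -nE; apply/eqP; ring.
have [c tc] : exists c, t = 3 * c.
  exists (t %/ 3)%Z; have := divz_eq t 3; move: (t %/ 3)%Z => c.
  have := modz_ge0 t (isT : (3 : int) != 0).
  have := ltz_mod t (isT : (3 : int) != 0).
  move: (t %% 3)%Z => r Hr Hr' tr.
  have : r = 0 \/ r = 1 \/ r = 2 by lia.
  by case=> [r0|[r0|r0]]; move: tn; rewrite tr r0; nia.
have cm : 3 * c ^+ 2 = m ^+ 2 - 4 * n by nia.
have parity (z : int) : exists k, z = 2 * k \/ z = 2 * k + 1.
  exists (z %/ 2)%Z; have := divz_eq z 2; move: (z %/ 2)%Z => k.
  have := modz_ge0 z (isT : (2 : int) != 0).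
  have := ltz_mod z (isT : (2 : int) != 0).
  by move: (z %% 2)%Z => r; lia.
have [m' mm] := parity m; have [c' cc] := parity c.
have {mm cc} [mm cc] : m = 2 * m' /\ c = 2 * c' by case: mm; case: cc; nia.
exists m', c'; rewrite xE /zsqrt3 -!(ratr_int algC).
have -> : a = m'%:~R.
  by apply: (mulfI (_ : 2 != 0)) => //; rewrite mE mm rmorphM.
suff -> : b = c'%:~R by [].
apply: (mulfI (_ : 6 != 0)) => //; rewrite tE tc cc.
by rewrite !rmorphM /=; ring.
Qed.

Local Open Scope classical_set_scope.

(** * Ideals of the ring of integers *)

Definition principal (a b : int) : set algC :=
  [set zsqrt3 a b * w | w in O_L].

Lemma O_L_zsqrt3 a b : O_L (zsqrt3 a b).
Proof. by apply/O_LP; exists a, b. Qed.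

Lemma principalP a b c d : principal a b (zsqrt3 c d) <->
  exists u v, c = a * u + 3 * (b * v) /\ d = a * v + b * u.
Proof.
split=> [[w /O_LP [u [v ->]]]|[u [v [-> ->]]]].
  by rewrite zsqrt3M => /zsqrt3_inj [<- <-]; exists u, v.
by exists (zsqrt3 u v); rewrite ?zsqrt3M //; apply/O_LP; exists u, v.
Qed.

Lemma principal_sub a b : principal a b `<=` O_L.
Proof.
by move=> _ [_ /O_LP [u [v ->]] <-]; rewrite zsqrt3M; exact: O_L_zsqrt3.
Qed.

Lemma principal_ideal a b : is_ideal (principal a b).
Proof.
split; first exact: principal_sub.
- exists 0; rewrite ?mulr0 //; apply/O_LP; exists 0, 0.
  by rewrite /zsqrt3 mul0r addr0.
- move=> _ _ [_ /O_LP [u [v ->]] <-] [_ /O_LP [u' [v' ->]] <-].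
  rewrite -mulrDr zsqrt3D; exists (zsqrt3 (u + u') (v + v')) => //.
  exact: O_L_zsqrt3.
- move=> _ _ /O_LP [u [v ->]] [_ /O_LP [u' [v' ->]] <-].
  by rewrite mulrCA zsqrt3M; eexists; last by []; apply/O_LP; eexists; eexists.
Qed.

Lemma zsqrt3_0 : zsqrt3 0 0 = 0. Proof. by rewrite /zsqrt3 mul0r addr0. Qed.

Lemma principal_gen a b : principal a b (zsqrt3 a b).
Proof. by apply/principalP; exists 1, 0; split; ring. Qed.

Lemma principal_neq0 a b : (a, b) != (0, 0) -> principal a b <> [set 0].
Proof.
move=> ab0 E; have := principal_gen a b; rewrite E /= => /zsqrt3_eq0 [a0 b0].
by rewrite a0 b0 in ab0.
Qed.

Lemma principal_subset a b c d :
  principal a b (zsqrt3 c d) -> principal c d `<=` principal a b.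
Proof.
have [_ _ _ HM] := principal_ideal a b.
by move=> cd _ [w wO <-]; rewrite mulrC; apply: HM.
Qed.

Lemma principal_unit a b c d : nrm3 c d = 1 ->
  principal (a * c + 3 * (b * d)) (a * d + b * c) = principal a b.
Proof.
move=> n1; apply/seteqP; split; apply: principal_subset.
  by apply/principalP; exists c, d.
apply/principalP; exists c, (- d); split.
  by rewrite -[LHS]mulr1 -[in LHS]n1 /nrm3; ring.
by rewrite -[LHS]mulr1 -[in LHS]n1 /nrm3; ring.
Qed.

Lemma principal_opp a b : principal (- a) (- b) = principal a b.
Proof.
by apply/seteqP; split; apply: principal_subset; apply/principalP;
  exists (-1), 0; split; ring.
Qed.

(** A nonzero element of minimal absolute norm generates, by Euclidean
    division. *)
Lemma ideal_principal I : is_ideal I -> I <> [set 0] ->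
  exists a b, (a, b) != (0, 0) /\ I = principal a b.
Proof.
move=> [IO I0 ID IM] In0.
pose P n :=
  `[< exists a b, [/\ I (zsqrt3 a b), (a, b) != (0, 0) & n = `|nrm3 a b|%N] >].
have exP : exists n, P n.
  apply: contrapT => nP; apply: In0; apply/seteqP; split=> [x Ix|_ -> //].
  have /O_LP [a [b xE]] := IO _ Ix.
  apply: contrapT => xn0; apply: nP; exists `|nrm3 a b|%N; apply/asboolP.
  exists a, b; split; rewrite -?xE //.
  by apply/eqP => -[a0 b0]; apply: xn0; rewrite xE a0 b0 zsqrt3_0.
have [_ /asboolP [a [b [Iab ab0 ->]]] nmin] := ex_minnP exP.
exists a, b; split=> //; apply/seteqP; split=> [x Ix|_ [w wO <-]]; last first.
  by rewrite mulrC; apply: IM.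
have /O_LP [c [d xE]] := IO _ Ix; rewrite xE in Ix *.
have [u [v lt]] := nrm3_euclid c d ab0.
apply/principalP; exists u, v.
suff : (c - (a * u + 3 * (b * v)), d - (a * v + b * u)) == (0, 0).
  by rewrite xpair_eqE !subr_eq0 => /andP[/eqP -> /eqP ->].
apply: contraT => n0.
have /nmin : P `|nrm3 (c - (a * u + 3 * (b * v))) (d - (a * v + b * u))|%N.
  apply/asboolP; do 2!eexists; split; [|exact: n0|by []].
  have -> : zsqrt3 (c - (a * u + 3 * (b * v))) (d - (a * v + b * u)) =
            zsqrt3 c d + zsqrt3 (- u) (- v) * zsqrt3 a b.
    by rewrite zsqrt3M zsqrt3D; congr zsqrt3; ring.
  by apply: ID => //; apply: IM => //; apply/O_LP; exists (- u), (- v).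
by rewrite -lez_nat !abszE leNgt lt.
Qed.

Definition coset (I : set algC) (x : algC) := [set x + y | y in I].

Lemma coset_eq a b x y : O_L x -> O_L y ->
  coset (principal a b) x = coset (principal a b) y <-> principal a b (x - y).
Proof.
have [_ P0 PD PM] := principal_ideal a b.
have PN z : principal a b z -> principal a b (- z).
  move=> Pz; rewrite -mulN1r; apply: PM => //.
  by apply/O_LP; exists (-1), 0; rewrite /zsqrt3 mul0r addr0.
move=> xO yO; split=> [E|xy].
  have : coset (principal a b) y x by rewrite -E; exists 0; rewrite ?addr0.
  by case=> z Pz <-; rewrite addrAC subrr add0r.
apply/seteqP; split=> _ [z Pz <-].
  by exists (x - y + z); [exact: PD | ring].
exists (- (x - y) + z); [apply: PD => //; exact: PN | ring].
Qed.

Lemma dvdz_sub_small (n j : int) (r s : nat) :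
  (r < `|n|)%N -> (s < `|n|)%N -> r%:Z - s%:Z = j * n -> r = s.
Proof.
move=> rn sn E; have [j0|j0] := eqVneq j 0; first by move: E; rewrite j0; lia.
have : (1 * `|n| <= `|j| * `|n|)%N by rewrite leq_mul2r absz_gt0 j0 orbT.
by rewrite -abszM -E; lia.
Qed.

(** Let g = gcd(a, b) and m = N(a + b sqrt3)/g. In the lattice spanned by the
    ideal, second coordinates run over the multiples of g, and the elements
    with second coordinate 0 are the multiples of m. So the i + j sqrt3 with
    0 <= i < |m| and 0 <= j < |g| represent each coset once; they are numbered
    by i |g| + j. *)
Lemma ideal_norm_principal a b : (a, b) != (0, 0) ->
  ideal_norm (principal a b) = `|nrm3 a b|%N.
Proof.
move=> ab0.
have g0 : gcdz a b != 0 by rewrite gcdz_eq0; move: ab0; rewrite xpair_eqE.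
have [u [v uv]] := Bezoutz a b.
have := dvdz_gcdl a b; have := dvdz_gcdr a b.
move: (gcdz a b) g0 uv => g g0 uv /dvdzP [b' bE] /dvdzP [a' aE].
have uv1 : u * a' + v * b' = 1.
  by apply: (mulIf g0); rewrite mul1r -[RHS]uv aE bE; ring.
pose m : int := g * nrm3 a' b'.
have n0 : nrm3 a' b' != 0.
  apply/eqP => /nrm3_eq0 [a0 b0]; move: uv1; rewrite a0 b0; lia.
have m0 : m != 0 by rewrite mulf_neq0.
have nE : `|nrm3 a b|%N = (`|g| * `|m|)%N.
  by rewrite -abszM; congr absz; rewrite aE bE /m /nrm3; ring.
have mem0 x : principal a b (zsqrt3 x 0) <-> (m %| x)%Z.
  split=> [/principalP [c [d [xE E]]]|/dvdzP [k ->]].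
    apply/dvdzP; exists (u * c - v * d).
    have E' : a' * d + b' * c = 0.
      by apply: (mulIf g0); rewrite mul0r {1}E aE bE; ring.
    have cE : c = (u * c - v * d) * a'.
      transitivity ((u * a' + v * b') * c - v * (a' * d + b' * c)).
        by rewrite uv1 E'; ring.
      by ring.
    have dE : d = - ((u * c - v * d) * b').
      transitivity ((u * a' + v * b') * d - u * (a' * d + b' * c)).
        by rewrite uv1 E'; ring.
      by ring.
    move: (u * c - v * d) cE dE => k cE dE.
    by rewrite xE cE dE aE bE /m /nrm3; ring.
  apply/principalP; exists (k * a'), (- (k * b')).
  by rewrite aE bE /m /nrm3; split; ring.
have memg x y : principal a b (zsqrt3 x y) -> (g %| y)%Z.
  case/principalP => c [d [_ ->]]; rewrite aE bE.
  by apply/dvdzP; exists (a' * d + b' * c); ring.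
have [t tP] : exists t, principal a b (zsqrt3 t g).
  exists (a * v + 3 * (b * u)); apply/principalP; exists v, u; split => //.
  by rewrite -uv; ring.
have [_ _ PD PM] := principal_ideal a b.
rewrite /ideal_norm nE; apply: card_fset_set.
rewrite card_eq_sym; apply/card_set_bijP.
pose G k := coset (principal a b) (zsqrt3 (k %/ `|g|)%N (k %% `|g|)%N).
exists G; split.
- move=> k _; exists (zsqrt3 (k %/ `|g|)%N (k %% `|g|)%N) => //.
  exact: O_L_zsqrt3.
- move=> k l; rewrite !inE /= => km lm.
  move/(coset_eq _ _ (O_L_zsqrt3 _ _) (O_L_zsqrt3 _ _)) => H.
  rewrite zsqrt3B in H; have /dvdzP [j jE] := memg _ _ H.
  have gn : (0 < `|g|)%N by rewrite absz_gt0.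
  have := ltn_pmod k gn; have := ltn_pmod l gn => lg kg.
  have kl := dvdz_sub_small kg lg jE.
  move: H; rewrite kl subrr => /mem0 /dvdzP [j' j'E].
  have kM : (k %/ `|g| < `|m|)%N by rewrite ltn_divLR // mulnC.
  have lM : (l %/ `|g| < `|m|)%N by rewrite ltn_divLR // mulnC.
  rewrite (divn_eq k `|g|) (divn_eq l `|g|) kl; congr (_ * _ + _)%N.
  exact: dvdz_sub_small kM lM j'E.
- move=> _ [_ /O_LP [x [y ->]] <-].
  pose s := (y %/ g)%Z; pose x' := x - s * t.
  pose k := (`|(x' %% m)%Z| * `|g| + `|(y %% g)%Z|)%N.
  have gn : (0 < `|g|)%N by rewrite absz_gt0.
  have yg : (`|(y %% g)%Z| < `|g|)%N.
    by rewrite -ltz_nat !abszE (ger0_norm (modz_ge0 _ g0)) ltz_mod.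
  have xm : (`|(x' %% m)%Z| < `|m|)%N.
    by rewrite -ltz_nat !abszE (ger0_norm (modz_ge0 _ m0)) ltz_mod.
  exists k; first by rewrite /= /k; nia.
  have kd : (k %/ `|g| = `|(x' %% m)%Z|)%N.
    by rewrite divnMDl // divn_small ?addn0.
  have kr : (k %% `|g| = `|(y %% g)%Z|)%N by rewrite modnMDl modn_small.
  apply/(coset_eq _ _ (O_L_zsqrt3 _ _) (O_L_zsqrt3 _ _)).
  rewrite kd kr !gez0_abs ?modz_ge0 // zsqrt3B.
  have -> : zsqrt3 ((x' %% m)%Z - x) ((y %% g)%Z - y) =
    zsqrt3 (- s) 0 * zsqrt3 t g + zsqrt3 ((- (x' %/ m)%Z) * m) 0.
    by rewrite /modz -/s {1}/x' zsqrt3M zsqrt3D; congr zsqrt3; ring.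
  apply: PD.
    by apply: PM => //; apply/O_LP; exists (- s), 0.
  by apply/mem0; apply/dvdzP; eexists.
Qed.

(** * Reduced generators *)

(** Two generators of one ideal with the same norm differ by a unit of norm 1.
    If its second coordinate is nonzero, then the unit or its inverse
    contradicts [reduced_no_pos_unit]. *)
Lemma reduced_unique (u y u' y' : int) :
  0 < u -> 0 < y -> 2 * u < 3 * y -> 0 < u' -> 0 < y' -> 2 * u' < 3 * y' ->
  nrm3 (- u) y = nrm3 (- u') y' -> principal (- u) y = principal (- u') y' ->
  u = u' /\ y = y'.
Proof.
move=> u0 y0 uy u'0 y'0 uy' nE pE.
have /principalP [c [d [Eu Ey]]] : principal (- u) y (zsqrt3 (- u') y').
  by rewrite pE; exact: principal_gen.
have n1 : nrm3 c d = 1.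
  have n0 : nrm3 (- u) y != 0 by apply/eqP => /nrm3_eq0 []; lia.
  by apply: (mulfI n0); rewrite mulr1 -nrm3M -Eu nE; congr nrm3; rewrite Ey.
have c2 : c ^+ 2 = 1 + 3 * d ^+ 2.
  by rewrite -[LHS](subrK (3 * d ^+ 2)) -/(nrm3 c d) n1.
have [d0|d0|d0] := ltrgt0P d.
- by case: (@reduced_no_pos_unit u y c d) => //; nia.
- case: (@reduced_no_pos_unit u' y' c (- d)) => //; rewrite ?sqrrN ?oppr_gt0 //.
    have -> : c * u' - 3 * (- d * y') = (nrm3 c d) * u.
      by rewrite -[u']opprK Eu Ey /nrm3; ring.
    by rewrite n1 mul1r.
  have -> : c * y' - - d * u' = (nrm3 c d) * y.
    by rewrite -[u']opprK Eu Ey /nrm3; ring.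
  by rewrite n1 mul1r.
- have {}c2 : c = 1 \/ c = - 1.
    by move: c2; rewrite d0; nia.
  by move: Eu Ey; rewrite d0; case: c2 => ->; nia.
Qed.

(** Among the generators [c + d sqrt3] with d > 0, one with c + 3d minimal is
    reduced: c + 3d cannot decrease under multiplication by
    [2 + sqrt3] or its inverse, which says 2c + 3d >= 0 and
    c <= 0. Equality is excluded since 3 does not divide c. *)
Lemma reduced_exists a b : nrm3 a b < 0 -> ~~ (3 %| a)%Z ->
  exists u y : int,
    [/\ 0 < u, 0 < y, 2 * u < 3 * y & principal a b = principal (- u) y].
Proof.
move=> nab a3.
pose good c d :=
  [/\ nrm3 c d < 0, ~~ (3 %| c)%Z, 0 < d & principal a b = principal c d].
have good0 c d : good c d -> c ^+ 2 < 3 * d ^+ 2.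
  by case; rewrite /nrm3 subr_lt0.
have goodX c d : good c d -> 0 < c + 3 * d.
  by move=> g; have := good0 _ _ g; case: g => _ _ d0 _; nia.
pose P n := `[< exists c d, good c d /\ n = `|(c + 3 * d)%R|%N >].
have exP : exists n, P n.
  have [b0|b0|b0] := ltrgt0P b.
  - by exists `|(a + 3 * b)%R|%N; apply/asboolP; exists a, b.
  - exists `|(- a + 3 * - b)%R|%N; apply/asboolP; exists (- a), (- b).
    split=> //.
    split; rewrite ?oppr_gt0 ?principal_opp ?rpredN //.
    by move: nab; rewrite /nrm3 !sqrrN.
  - by move: nab; rewrite b0 /nrm3; nia.
have [_ /asboolP [c [d [gcd ->]]] nmin] := ex_minnP exP.
(* f = 1 and f = -1 give multiplication by 2 + sqrt3 and by its inverse. *)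
have min_unit f : f ^+ 2 = 1 -> 0 < c * f + d * 2 ->
    c + 3 * d <= (c * 2 + 3 * (d * f)) + 3 * (c * f + d * 2).
  move=> f2 d'0; have n1 : nrm3 2 f = 1 by rewrite /nrm3 f2.
  have g' : good (c * 2 + 3 * (d * f)) (c * f + d * 2).
    have [n0 c3 d0 pE] := gcd; split=> //.
    - by rewrite nrm3M n1 mulr1.
    - apply: contra c3 => /dvdzP [k kE].
      by apply/dvdzP; exists (c + d * f - k); lia.
    - by rewrite pE principal_unit.
  have /nmin : P `|(c * 2 + 3 * (d * f) + 3 * (c * f + d * 2))%R|%N.
    by apply/asboolP; do 2!eexists; split; first exact: g'.
  by have := goodX _ _ g'; have := goodX _ _ gcd; lia.
have := good0 _ _ gcd; have [_ c3 d0 pE] := gcd => lt.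
have cn0 : c != 0 by apply: contra c3 => /eqP ->.
exists (- c), d; rewrite opprK; split=> //.
  have : c + 3 * d <= (c * 2 + 3 * (d * -1)) + 3 * (c * -1 + d * 2).
    by apply: min_unit => //; nia.
  lia.
have : c + 3 * d <= (c * 2 + 3 * (d * 1)) + 3 * (c * 1 + d * 2).
  by apply: min_unit => //; nia.
have : 3 * d + 2 * c != 0.
  by apply: contra c3 => /eqP E; apply/dvdzP; exists (c + d); lia.
lia.
Qed.

(** * Matching exponents with ideals *)

(** The triples (e, (k, l)) parametrize the reduced pairs (u, y) with u not
    divisible by 3: u = 3k + 1 + e determines k and e, and 2u < 3y is
    equivalent to y >= 2k + 1 + e. *)
Definition reduced_params : set (nat * (nat * nat)) := `I_2 `*` (setT `*` setT).

Definition reduced_ideal (t : nat * (nat * nat)) : set algC :=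
  let: (e, (k, l)) := t in
  principal (- (3 * k + 1 + e)%N%:Z) (2 * k + l + 1 + e)%N%:Z.

(** The point of contact of the two halves: the norm of a reduced generator is
    an exponent of the theta series for f8, up to [q -> q^3] and division by
    q. *)
Lemma reduced_nrm3 e k l : (e < 2)%N ->
  nrm3 (- (3 * k + 1 + e)%N%:Z) (2 * k + l + 1 + e)%N%:Z
  = - (3 * theta_exp e k l).-1%:Z.
Proof.
move=> e2; have -> : (3 * theta_exp e k l).-1%:Z = 3 * (theta_exp e k l)%:Z - 1.
  have : (0 < theta_exp e k l)%N by rewrite /theta_exp !addn1.
  by lia.
rewrite /nrm3 /theta_exp; case: e e2 => [|[|//]] _; rewrite !PoszD !PoszM; ring.
Qed.

Lemma reduced_ideal_norm e k l : (e < 2)%N ->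
  ideal_norm (reduced_ideal (e, (k, l))) = (3 * theta_exp e k l).-1.
Proof.
move=> e2; rewrite ideal_norm_principal ?reduced_nrm3 ?abszN //.
by rewrite xpair_eqE negb_and; apply/orP; left; lia.
Qed.

(** Squares are 0 or 1 modulo 3, so the norm itself cannot be 2 modulo 3. *)
Lemma nrm3_mod3 a b : (`|nrm3 a b| = 2 %[mod 3])%N ->
  nrm3 a b < 0 /\ ~~ (3 %| a)%Z.
Proof.
rewrite /nrm3 => E.
have := divz_eq a 3; have := modz_ge0 a (isT : (3 : int) != 0).
have := ltz_mod a (isT : (3 : int) != 0).
have -> : (3 %| a)%Z = ((a %% 3)%Z == 0) by apply/dvdz_mod0P/eqP.
move: (a %/ 3)%Z (a %% 3)%Z => c r r1 r2 aE.
have XE : a ^+ 2 - 3 * b ^+ 2 = 3 * (3 * c ^+ 2 + 2 * c * r - b ^+ 2) + r ^+ 2.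
  by rewrite aE; ring.
move: E; rewrite XE; move: (3 * c ^+ 2 + 2 * c * r - b ^+ 2) => X.
have : r = 0 \/ r = 1 \/ r = 2 by lia.
by case=> [->|[->|->]] E; split=> //; lia.
Qed.

Lemma reduced_ideal_bij :
  set_bij reduced_params [set a : set algC | [/\ is_ideal a, a <> [set 0]
                                 & ideal_norm a = 2 %[mod 3]]] reduced_ideal.
Proof.
split.
- move=> [e [k l]] [/= e2 _]; split; first exact: principal_ideal.
    by apply: principal_neq0; rewrite xpair_eqE negb_and; apply/orP; left; lia.
  rewrite (reduced_ideal_norm _ _ e2).
  have : (0 < theta_exp e k l)%N by rewrite /theta_exp !addn1.
  move: (theta_exp _ _ _) => n n0.
  have -> : ((3 * n).-1 = n.-1 * 3 + 2)%N by lia.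
  by rewrite modnMDl.
- move=> [e [k l]] [e' [k' l']]; rewrite !inE => -[/= e2 _] [/= e2' _] E.
  have nE : nrm3 (- (3 * k + 1 + e)%N%:Z) (2 * k + l + 1 + e)%N%:Z =
            nrm3 (- (3 * k' + 1 + e')%N%:Z) (2 * k' + l' + 1 + e')%N%:Z.
    rewrite !reduced_nrm3 //.
    rewrite -(reduced_ideal_norm k l e2) -(reduced_ideal_norm k' l' e2').
    by rewrite /reduced_ideal E.
  have [] := @reduced_unique _ _ _ _ _ _ _ _ _ _ nE E; try lia.
  move=> A B.
  have [kk ee] : k = k' /\ e = e' by lia.
  by congr (_, (_, _)); lia.
- move=> I [Iid In0 I2].
  have [a [b [ab0 IE]]] := ideal_principal Iid In0.
  move: I2; rewrite IE => I2; have := I2; rewrite ideal_norm_principal //.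
  move=> /nrm3_mod3 [nab a3].
  have [u [y [u0 y0 uy pE]]] := reduced_exists nab a3.
  have : ~~ (3 %| - u)%Z.
    apply: proj2 (nrm3_mod3 (b := y) _); rewrite -ideal_norm_principal -?pE //.
    by rewrite xpair_eqE negb_and; apply/orP; left; lia.
  rewrite rpredN => u3.
  have [k [e [e2 uE]]] :
      exists k e : nat, (e < 2)%N /\ u = (3 * k + 1 + e)%N%:Z.
    exists ((`|u| - 1) %/ 3)%N, ((`|u| - 1) %% 3)%N.
    by move: u3; rewrite /dvdz /=; lia.
  exists (e, (k, (`|y| - 2 * k - 1 - e)%N)); first by [].
  rewrite /= pE uE; congr principal; lia.
Qed.

Lemma fsbig_prod2 (V : nmodType) (T : choiceType) (B : set T) a
    (F : nat * T -> V) :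
  finite_set B ->
  \sum_(t \in `I_a `*` B) F t = \sum_(e < a) \sum_(x \in B) F (e : nat, x).
Proof.
move=> Bfin; rewrite (fsbig_ord +%R a (fun e => \sum_(x \in B) F (e, x))).
rewrite pair_fsbig; [|exact: finite_II|exact: Bfin].
by apply: eq_fsbigr => -[].
Qed.

Theorem theorem1p8 :
  let A := [set a : set algC | [/\ is_ideal a, a <> [set 0]
                                 & ideal_norm a = 2 %[mod 3]]] in
  let E := fun a : set algC =>
    (-1) ^+ ideal_norm a * q ^+ ideal_norm a : fps int in
  fps_summable A E /\ fps_divX (fps_dilate 3 f8) = fps_sum A E.
Proof.
move=> A E.
have reduced_bij : set_bij reduced_params A reduced_ideal := reduced_ideal_bij.
have E_coef e k l n : (e < 2)%N -> (E (reduced_ideal (e, (k, l)))).[^n] =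
    (-1) ^+ (k + l) * (n.+1 == 3 * theta_exp e k l)%N%:R.
  move=> e2; rewrite /E reduced_ideal_norm //.
  have E0 : (0 < theta_exp e k l)%N by rewrite /theta_exp !addn1.
  have -> : (n.+1 == 3 * theta_exp e k l)%N =
            (n == (3 * theta_exp e k l).-1)%N by lia.
  have -> : (-1) ^+ (3 * theta_exp e k l).-1 = (-1) ^+ (k + l) :> fps int.
    (* Modulo 2, the exponent 3 * theta_exp - 1 is theta_exp + 1, and
       theta_exp is (k + l + 1)^2. *)
    rewrite -signr_odd -[RHS]signr_odd; congr (_ ^+ nat_of_bool _).
    have -> : odd (3 * theta_exp e k l).-1 = ~~ odd (theta_exp e k l).
      by case: (theta_exp e k l) E0 => // x _; rewrite mulnS /= oddM negbK.
    by rewrite /theta_exp !(oddD, oddM) /=; case: (odd k); case: (odd l).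
  rewrite -signr_odd -[in RHS]signr_odd.
  by case: odd; rewrite ?mulN1r ?mul1r ?fps_coefN fps_coefXn.
have theta_exp_gt e k l : (k < theta_exp e k l)%N && (l < theta_exp e k l)%N.
  by rewrite /theta_exp; nia.
have small n e k l : (E (reduced_ideal (e, (k, l)))).[^n] != 0 -> (e < 2)%N ->
    (k < n.+1)%N && (l < n.+1)%N.
  move=> + e2; rewrite E_coef //.
  have [nE _|_] := eqVneq n.+1 (3 * theta_exp e k l)%N; last first.
    by rewrite mulr0 eqxx.
  have := theta_exp_gt e k l; lia.
split.
  move=> n; apply: (@sub_finite_set _ _
    (reduced_ideal @` (`I_2 `*` (`I_n.+1 `*` `I_n.+1)))).
    move=> I [IA In]; have [_ _ surj] := reduced_bij.
    have [[e [k l]] [/= e2 _] IE] := surj _ IA; exists (e, (k, l)) => //=.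
    split=> //; apply/andP; apply: (small n e) => //.
    by move: In; rewrite -IE.
  apply: finite_image; apply: finite_setX; first exact: finite_II.
  by apply: finite_setX; exact: finite_II.
apply/fpsP => n.
transitivity (\sum_(I \in A) (E I).[^n]); last by [].
transitivity (if (3 %| n.+1)%N then f8.[^n.+1 %/ 3] else 0); first by [].
rewrite (reindex_fsbig _ _ _ _ reduced_bij).
rewrite -(@fsbig_widen _ _ _ _ (`I_2 `*` (`I_n.+1 `*` `I_n.+1))); first last.
- move=> [e [k l]] [[/= e2 _] H].
  apply: contrapT => H'; apply: H; split=> //; apply/andP.
  by apply: (small n e) => //; apply/eqP.
- by move=> [e [k l]] [/= e2 _].
rewrite fsbig_prod2; last by apply: finite_setX; exact: finite_II.
transitivity (\sum_(e < 2) \sum_(k < n.+1) \sum_(l < n.+1)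
    (-1) ^+ (k + l) * (n.+1 == 3 * theta_exp e k l)%N%:R : int); last first.
  apply: eq_bigr => e _.
  rewrite (fsbig_prod2 _ (fun p => (E (reduced_ideal (e : nat, p))).[^n]));
    last exact: finite_II.
  apply: eq_bigr => k _.
  rewrite -(fsbig_ord +%R n.+1
    (fun l => (E (reduced_ideal (e : nat, (k : nat, l)))).[^n])).
  by apply: eq_bigr => l _; rewrite E_coef.
have [/dvdnP [m nE]|n3] := boolP (3 %| n.+1)%N.
  rewrite nE mulnK // (@f8_coef _ (m * 3)%N); last by lia.
  apply: eq_bigr => e _; apply: eq_bigr => k _; apply: eq_bigr => l _.
  by rewrite [(3 * _)%N]mulnC eqn_pmul2r.
rewrite big1 // => e _; rewrite big1 // => k _; rewrite big1 // => l _.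
have [nE|_] := eqVneq n.+1 (3 * theta_exp e k l)%N; last by rewrite mulr0.
by rewrite nE dvdn_mulr in n3.
Qed.
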